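(* Let $m$ be a positive integer and let $B=(b_1,\dots,b_n)$ be any Ferrers board. Then, as polynomials in $x$, $$ \sum_{k=0}^n r_{k,m}(B)\, x\downarrow_{n-k,m} = \prod_{j=1}^n \begin{cases} x+\lfloor b_j \rfloor_m -(j-1)m + \rho_m(z) &\text{if $j$ is the last index in its $m$-zone $z$,}\\ x+\lfloor b_j \rfloor_m -(j-1)m &\text{otherwise.} \end{cases} $$
   Context: The first quadrant is tiled by unit cells; a cell is given the coordinates $(i,j)$ of its northeast corner, so $i$ is its column and $j$ its row. A Ferrers board $B=(b_1,\dots,b_n)$, where $0\le b_1\le\dots\le b_n$ are integers, is the set of cells consisting of the $b_j$ lowest cells of column $j$, $1\le j\le n$. Fix a positive integer $m$. The $i$th level consists of rows $(i-1)m+1,\dots,im$. An $m$-level rook placement on $B$ is a subset $P\subseteq B$ no two of whose cells (rooks) lie in the same level or in the same column; $r_{k,m}(B)$ is the number of $m$-level rook placements on $B$ with $k$ rooks. The $m$-falling factorial is $x\downarrow_{n,m}=x(x-m)(x-2m)\cdots(x-(n-1)m)$ (equal to $1$ if $n=0$). For an integer $n$, $\lfloor n\rfloor_m$ is the largest multiple of $m$ that is $\le n$, and $\rho_m(n)=n-\lfloor n\rfloor_m$. An $m$-zone of $B$ is a maximal interval $z=[s,t]=\{s,s+1,\dots,t\}$ of column indices with $\lfloor b_s\rfloor_m=\lfloor b_{s+1}\rfloor_m=\dots=\lfloor b_t\rfloor_m$; its $m$-remainder is $\rho_m(z)=\sum_{j\in z}\rho_m(b_j)$. *)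

(* Defs.v *)
From mathcomp Require Import all_boot all_algebra.

Set Implicit Arguments.
Unset Strict Implicit.
Unset Printing Implicit Defensive.

Import GRing.Theory.

(* Columns, rows and levels are numbered from 0: the ordinal j stands for
   column j + 1, i for row i + 1, and row i lies in level i %/ m.  A board is
   given by its column heights b : 'I_n -> nat. *)

Section FerrersBoard.

Variables (m n : nat) (b : 'I_n -> nat).

Definition height : nat := \max_(j < n) b j.

(* A cell is a pair (column, row). *)
Definition board : {set 'I_n * 'I_height} :=
  [set c : 'I_n * 'I_height | c.2 < b c.1].

Definition level (i : nat) : nat := i %/ m.

Definition level_placement (P : {set 'I_n * 'I_height}) : bool :=
  (P \subset board) &&
  [forall c in P, forall d in P,
     (c != d) ==> (c.1 != d.1) && (level c.2 != level d.2)].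

Definition rook_number (k : nat) : nat :=
  #|[set P | level_placement P & #|P| == k]|.

Definition mfloor (a : nat) : nat := \max_(k < a.+1 | m %| k) k.

Definition mrem (a : nat) : nat := a - mfloor a.

Definition col_interval (s t : 'I_n) : {set 'I_n} :=
  [set j : 'I_n | s <= j <= t].

Definition floor_constant (A : {set 'I_n}) : bool :=
  [exists s : 'I_n, exists t : 'I_n, (s <= t) && (A == col_interval s t)] &&
  [forall i in A, forall j in A, mfloor (b i) == mfloor (b j)].

Definition zones : {set {set 'I_n}} := [set z | maxset floor_constant z].

Definition zone_rem (z : {set 'I_n}) : nat := \sum_(j in z) mrem (b j).

(* The zones partition the columns, so pblock returns the zone of j. *)
Definition zone_of (j : 'I_n) : {set 'I_n} := pblock zones j.

Definition last_in_zone (j : 'I_n) : bool := [forall i in zone_of j, i <= j].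

End FerrersBoard.

Definition mfalling (R : pzRingType) (m : nat) (x : R) (n : nat) : R :=
  (\prod_(i < n) (x - (i * m)%:R))%R.

(* Main.v *)
(* Let F_p, A_p and C_p be the sums of x↓_{p - |P|} over the placements P on the
   first p columns: all of them, those avoiding level q, and those using level q
   (columns and levels are numbered from 0).  If floor(b_p) = qm, then a rook in
   column p can be added to P below level q in qm - m|P| ways when P avoids level
   q and in qm - m(|P| - 1) ways otherwise, and in level q in rho(b_p) ways,
   respectively 0 ways.  Hence
     A_{p+1} = (x + qm - pm) A_p,
     C_{p+1} = (x + qm - (p-1)m) C_p + rho(b_p) A_p,
   so C_{p+1} = R A_p by induction inside a zone, R being the sum of the remainders
   up to column p, and at the end of a zone
   F_{p+1} = A_{p+1} + C_{p+1} = (x + qm - pm + R) A_p, which is also the A_{p+1}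
   of the next zone, since no rook has yet been placed in its top level. *)
Require Import Defs.
From mathcomp Require Import all_boot all_algebra.
From mathcomp Require Import ring zify.

Set Implicit Arguments.
Unset Strict Implicit.
Unset Printing Implicit Defensive.

Import GRing.Theory.
Local Open Scope ring_scope.

(** * Arithmetic of floors, falling factorials and levels *)

Lemma mfloorE (m a : nat) : (0 < m)%N -> mfloor m a = (a %/ m * m)%N.
Proof.
move=> m_gt0; apply/eqP; rewrite eqn_leq; apply/andP; split.
  apply/bigmax_leqP => k dvd_mk.
  by rewrite -(divnK dvd_mk) leq_mul2r leq_div2r ?orbT // -ltnS.
have lt_fl : (a %/ m * m < a.+1)%N by rewrite ltnS leq_divM.
by apply: (leq_bigmax_cond (Ordinal lt_fl)); rewrite dvdn_mull.
Qed.

Lemma mremE (m a : nat) : (0 < m)%N -> mrem m a = (a %% m)%N.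
Proof. by move=> m_gt0; rewrite /mrem mfloorE // {1}(divn_eq a m) addKn. Qed.

Lemma mfallingS (R : comPzRingType) (m : nat) (x : R) (k : nat) :
  mfalling m x k.+1 = (x - (k * m)%:R) * mfalling m x k.
Proof. by rewrite /mfalling big_ord_recr mulrC. Qed.

Lemma card_ord_lt (k a : nat) : (a <= k)%N ->
  #|[pred i : 'I_k | (i < a)%N]| = a.
Proof.
move=> le_ak; rewrite -sum1_card -(big_ord_widen _ (fun=> 1%N)) //.
by rewrite sum_nat_const card_ord muln1.
Qed.

(** This counts the rows that one rook blocks below row [q * m]. *)
Lemma sum_divn_eq (m q l : nat) : (0 < m)%N ->
  (\sum_(i < q * m) (i %/ m == l) = m * (l < q))%N.
Proof.
move=> m_gt0; rewrite -(big_mkord xpredT (fun i => (i %/ m == l) : nat)%N).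
elim: q => [|q IHq]; first by rewrite mul0n big_geq // muln0.
rewrite mulSn addnC (big_cat_nat (n := (q * m)%N)) ?leq_addr //= IHq.
have -> : (\sum_(q * m <= i < q * m + m) (i %/ m == l) = m * (q == l))%N.
  rewrite -{1}[(q * m)%N]add0n big_addn addKn big_mkord.
  under eq_bigr => i _ do rewrite addnC divnMDl // divn_small // addn0.
  by rewrite sum_nat_const card_ord.
by rewrite -mulnDr ltnS [(l <= q)%N]leq_eqVlt eq_sym; case: ltngtP.
Qed.

(** * Placements on the first columns, and adding a rook in the next one *)

Section Placements.

Variables (m n : nat) (b : 'I_n -> nat).
Hypothesis m_gt0 : (0 < m)%N.
Hypothesis b_mono : forall i j : 'I_n, (i <= j)%N -> (b i <= b j)%N.

Local Notation cell := ('I_n * 'I_(height b))%type.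
Implicit Types (P : {set cell}) (p : 'I_n) (i : 'I_(height b)).

Definition prefix_placement (p : nat) P : bool :=
  level_placement m P && [forall c in P, (c.1 < p)%N].

Definition uses (q : nat) P : bool := [exists c in P, level m c.2 == q].

(** Only the level is tested: for a placement on earlier columns, no column conflict can arise. *)
Definition free p P i : bool := (i < b p)%N && ~~ uses (level m i) P.

Lemma prefix_placementP (p : nat) P :
  reflect [/\ forall c, c \in P -> (c.2 < b c.1)%N,
              forall c, c \in P -> (c.1 < p)%N
            & forall c d, c \in P -> d \in P -> c != d ->
                c.1 != d.1 /\ level m c.2 != level m d.2]
          (prefix_placement p P).
Proof.
apply: (iffP idP) => [/andP[/andP[/subsetP sPB attP] /forall_inP ltP]|].
  split=> // [c /sPB|c d Pc Pd ne_cd]; first by rewrite inE.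
  move/forall_inP/(_ c Pc)/forall_inP/(_ d Pd): attP.
  by rewrite ne_cd => /andP[].
case=> leP ltP attP; apply/andP; split; last exact/forall_inP.
apply/andP; split; first by apply/subsetP=> c /leP; rewrite inE.
apply/forall_inP=> c Pc; apply/forall_inP=> d Pd; apply/implyP=> ne_cd.
exact/andP/attP.
Qed.

Lemma freeP p P i :
  reflect ((i < b p)%N /\ forall c, c \in P -> level m c.2 != level m i)
          (free p P i).
Proof.
by rewrite /free negb_exists_in; apply: (iffP andP) => -[? /forall_inP].
Qed.

Lemma placement_notin p P i : prefix_placement p P -> (p, i) \notin P.
Proof.
by case/prefix_placementP=> _ ltP _; apply/negP=> /ltP /=; rewrite ltnn.
Qed.

(** The second conjunct on the left says that [(p, i)] is not in [P], in the form that
    [reindex_onto] produces. *)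
Lemma placementU1 p P i :
  [&& prefix_placement p.+1 ((p, i) |: P) & ((p, i) |: P) :\ (p, i) == P]
  = prefix_placement p P && free p P i.
Proof.
apply/andP/andP=> [[/prefix_placementP[leP ltP attP] /eqP defP]|].
  have sP c : c \in P -> c \in (p, i) |: P by move=> Pc; rewrite !inE Pc orbT.
  have pi_in : (p, i) \in (p, i) |: P by rewrite setU11.
  have neP c : c \in P -> c != (p, i).
    by rewrite -defP !inE => /andP[].
  split.
    apply/prefix_placementP; split=> [c /sP/leP //|c Pc|c d /sP Pc /sP Pd].
      have := ltP _ (sP _ Pc); rewrite ltnS leq_eqVlt => /orP[/eqP e|//].
      case: (attP _ _ (sP _ Pc) pi_in (neP _ Pc)) => /=.
      by rewrite -val_eqE /= e eqxx.
    exact: attP.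
  apply/freeP; split=> [|c Pc]; first exact: leP _ pi_in.
  by case: (attP _ _ (sP _ Pc) pi_in (neP _ Pc)).
case=> plP /freeP[lt_ib frP]; have piP := placement_notin i plP.
case/prefix_placementP: (plP) => leP ltP attP.
have ne1 c : c \in P -> c.1 != p.
  by move/ltP=> lt_cp; apply: contraTneq lt_cp => ->; rewrite ltnn.
split; last by rewrite setU1K.
apply/prefix_placementP; split=> [c|c|c d]; rewrite !inE.
- by case/predU1P=> [->|/leP].
- by case/predU1P=> [->|/ltP/ltnW] //=; rewrite ltnS.
case/predU1P=> [->|Pc]; case/predU1P=> [->|Pd]; rewrite ?eqxx //= => ne_cd.
- by rewrite eq_sym ne1 // eq_sym frP.
- by rewrite ne1 // frP.
exact: attP.
Qed.

(** Column [p] is either empty or carries one rook, whose removal leaves a placement on the earlier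
    columns. *)
Lemma big_prefixS (V : nmodType) p (g : {set cell} -> V) :
  \sum_(P | prefix_placement p.+1 P) g P =
  \sum_(P | prefix_placement p P)
     (g P + \sum_(i | free p P i) g ((p, i) |: P)).
Proof.
rewrite big_split /= (bigID (fun P => [forall c in P, c.1 != p])) /=.
congr (_ + _).
  apply: eq_bigl => P; apply/andP/prefix_placementP.
    case=> /prefix_placementP[leP ltP attP] /forall_inP neP.
    split=> // c Pc; have := ltP c Pc; rewrite ltnS leq_eqVlt.
    by rewrite val_eqE (negPf (neP c Pc)).
  case=> leP ltP attP; split.
    by apply/prefix_placementP; split=> // c /ltP/ltnW; rewrite ltnS.
  apply/forall_inP=> c /ltP lt_cp.
  by apply: contraTneq lt_cp => ->; rewrite ltnn.
(* A placement with a rook in column [p] contains exactly one cell [(p, i)], so the sum over [i]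
   counts it once. *)
transitivity (\sum_i \sum_(P | prefix_placement p.+1 P && ((p, i) \in P)) g P).
  rewrite [RHS](exchange_big_dep (prefix_placement p.+1)) /=; last first.
    by move=> i P _ /andP[].
  rewrite big_mkcondr /=; apply: eq_bigr => P plP.
  case: ifPn => [/forall_inPn[[c1 i] Pc /negPn/eqP/= def_c]|]; last first.
    rewrite negbK => /forall_inP neP; rewrite big_pred0 // => i.
    by apply/negP=> /andP[_ /neP]; rewrite eqxx.
  subst c1; rewrite (big_pred1 i) // => j /=; rewrite plP /=.
  apply/idP/eqP=> [Pj|->//]; apply: contraTeq plP => ne_ji.
  apply/negP=> /prefix_placementP[_ _ /(_ _ _ Pj Pc)[]] /=.
    by rewrite xpair_eqE eqxx.
  by rewrite eqxx.
rewrite [RHS](exchange_big_dep xpredT) //=; apply: eq_bigr => i _.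
rewrite (reindex_onto (fun P => (p, i) |: P) (fun P => P :\ (p, i))) /=.
  by apply: eq_bigl => P; rewrite setU11 andbT placementU1.
by move=> P /andP[_ ?]; rewrite setD1K.
Qed.

(** * Counting the free cells of the next column *)

Lemma level_le_prefix p P c :
  prefix_placement p P -> c \in P -> (level m c.2 <= b p %/ m)%N.
Proof.
case/prefix_placementP=> leP ltP _ Pc; apply: leq_div2r.
exact/ltnW/(leq_trans (leP c Pc))/b_mono/ltnW/ltP.
Qed.

Lemma sum_level (k l : nat) P : prefix_placement k P ->
  (\sum_(c in P) (level m c.2 == l) = uses l P)%N.
Proof.
case/prefix_placementP=> _ _ attP.
case: (boolP (uses l P)) => [/exists_inP[c Pc /eqP lc]|/exists_inPn noP].
  rewrite (bigD1 c) //= lc eqxx big1 // => d /andP[Pd ne_dc].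
  by case: (attP d c Pd Pc ne_dc) => _; rewrite lc => /negPf->.
by rewrite big1 // => c /noP /negPf->.
Qed.

Lemma leq_height p : (b p <= height b)%N.
Proof. exact: leq_bigmax. Qed.

(** A rook below level [q] blocks the [m] rows of its level, all of which meet column [p]; a rook in
    level [q] blocks nothing below it, whence the term [m * uses q P]. The additive form avoids
    truncated subtraction. *)
Lemma card_free_below p P (q := (b p %/ m)%N) : prefix_placement p P ->
  (#|[pred i | free p P i & level m i != q]| + m * #|P|
   = q * m + m * uses q P)%N.
Proof.
move=> plP.
have le_qb : (q * m <= b p)%N by apply: leq_divM.
have le_qh : (q * m <= height b)%N := leq_trans le_qb (leq_height p).
(* No rook lies above level [q], since the heights increase, and at most one lies in it. *)
have cardP : (#|P| = \sum_(c in P) (level m c.2 < q) + uses q P)%N.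
  rewrite -(sum_level q plP) -big_split -sum1_card; apply: eq_bigr => c Pc /=.
  by have := level_le_prefix plP Pc; rewrite -/q; case: ltngtP.
rewrite cardP mulnDr addnA; congr (_ + _)%N.
rewrite -[RHS](card_ord_lt le_qh) big_distrr /=.
under eq_bigr => c _ do rewrite -(sum_divn_eq _ _ m_gt0).
rewrite exchange_big /=.
rewrite (big_ord_widen _
  (fun i : nat => \sum_(c in P) (i %/ m == level m c.2)%N)%N le_qh).
(* Both sides become sums over all rows and are compared row by row. *)
rewrite -!sum1_card big_mkcondr [in LHS]big_mkcond [X in (_ + X)%N]big_mkcond.
rewrite [RHS]big_mkcond -big_split; apply: eq_bigr => i _ /=.
under eq_bigr => c _ do rewrite eq_sym.
rewrite (sum_level _ plP) !inE /free /level.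
have : (i < b p)%N -> (i %/ m <= q)%N by move/ltnW/leq_div2r; apply.
have : (i %/ m < q)%N -> (i < b p)%N.
  by rewrite ltn_divLR // => /leq_trans; apply.
have <- : (i %/ m < q)%N = (i < q * m)%N by rewrite ltn_divLR.
case: (i < b p)%N; case: uses; case: ltngtP => //=; lia.
Qed.

(** Level [q] meets column [p] in the rows from [q * m] up to [b p - 1], all free when [P] avoids
    the level. *)
Lemma card_free_level p P (q := (b p %/ m)%N) : ~~ uses q P ->
  #|[pred i | free p P i & ~~ (level m i != q)]| = (b p %% m)%N.
Proof.
move=> noq; have le_qb : (q * m <= b p)%N by apply: leq_divM.
apply/eqP; rewrite -(eqn_add2l (q * m)) -divn_eq -(card_ord_lt (leq_height p)).
rewrite -{1}(card_ord_lt (leq_trans le_qb (leq_height p))) -!sum1_card.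
rewrite big_mkcond [X in (_ + X)%N]big_mkcond [X in _ == X]big_mkcond.
rewrite -big_split.
apply/eqP; apply: eq_bigr => i _ /=; rewrite !inE negbK /free /level.
have -> : (i < q * m)%N = (i %/ m < q)%N by rewrite ltn_divLR.
have : (i < b p)%N -> (i %/ m <= q)%N by move/ltnW/leq_div2r; apply.
have : (i %/ m < q)%N -> (i < b p)%N.
  by rewrite ltn_divLR // => /leq_trans; apply.
case: (ltngtP (i %/ m) q) => [_|_|->]; rewrite ?(negPf noq) ?noq ?andbF //=.
- by move=> ->.
- by case: (i < b p)%N => // _ /(_ isT).
- by case: (i < b p)%N.
Qed.

(** This makes [k - #|P|] in the falling factorials a true difference. *)
Lemma card_prefix_le (k : nat) P : prefix_placement k P -> (#|P| <= k)%N.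
Proof.
case/prefix_placementP=> _ ltP attP.
have inj1 : {in P &, injective fst}.
  move=> c d Pc Pd eq1; apply: contraTeq isT => ne_cd.
  by case: (attP c d Pc Pd ne_cd); rewrite eq1 eqxx.
rewrite -(card_in_imset inj1).
have sub : [set c.1 | c in P] \subset [pred j : 'I_n | (j < k)%N].
  by apply/subsetP=> _ /imsetP[c /ltP lt_ck ->].
apply: leq_trans (subset_leq_card sub) _.
case: (leqP k n) => [le_kn|/ltnW le_nk].
  by rewrite card_ord_lt.
by apply: leq_trans (max_card _) _; rewrite card_ord.
Qed.

Lemma uses_setU1 (l : nat) p P i :
  uses l ((p, i) |: P) = (level m i == l) || uses l P.
Proof.
apply/exists_inP/orP=> [[c /setU1P[->|Pc] lc]|[li|/exists_inP[c Pc lc]]].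
- by left.
- by right; apply/exists_inP; exists c.
- by exists (p, i); rewrite ?setU11.
by exists c; rewrite // setU1r.
Qed.

Lemma prefix_level_ltn (k q : nat) P :
    (forall j : 'I_n, (j < k)%N -> (b j %/ m < q)%N) ->
  prefix_placement k P -> uses q P = false.
Proof.
move=> lt_q /prefix_placementP[leP ltP _]; apply/exists_inP=> -[c Pc].
apply/negP; rewrite neq_ltn (leq_ltn_trans _ (lt_q _ (ltP c Pc))) //.
exact/leq_div2r/ltnW/leP.
Qed.

(** * Zones as the fibres of [b j %/ m] *)

Definition same_floor (j : 'I_n) : {set 'I_n} :=
  [set i : 'I_n | (b i %/ m == b j %/ m)%N].

Lemma floor_constant_sub (A : {set 'I_n}) (j : 'I_n) :
  floor_constant m b A -> j \in A -> A \subset same_floor j.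
Proof.
case/andP=> _ /forall_inP eqA Aj; apply/subsetP=> i Ai; rewrite inE.
move/forall_inP: (eqA i Ai) => /(_ j Aj).
by rewrite !mfloorE // eqn_pmul2r.
Qed.

(** By monotonicity the fibre is the whole interval from its least to its greatest element. *)
Lemma floor_constant_same_floor (j : 'I_n) : floor_constant m b (same_floor j).
Proof.
have jS : j \in same_floor j by rewrite inE.
apply/andP; split; last first.
  apply/forall_inP=> i; rewrite inE => /eqP eq_i; apply/forall_inP=> k.
  by rewrite inE => /eqP eq_k; rewrite !mfloorE // eq_i eq_k.
case: (@arg_minnP _ j (mem (same_floor j)) val jS) => s Ss min_s.
case: (@arg_maxnP _ j (mem (same_floor j)) val jS) => t St max_t.
apply/existsP; exists s; apply/existsP; exists t; rewrite min_s //=.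
apply/eqP/setP=> i; apply/idP/idP=> [Si|]; rewrite inE.
  by rewrite min_s //=; apply: max_t.
case/andP=> le_si le_it; move: Ss St; rewrite !inE => /eqP eq_s /eqP eq_t.
rewrite eqn_leq -{1}eq_t -eq_s.
by apply/andP; split; apply/leq_div2r/b_mono.
Qed.

Lemma zonesE (A : {set 'I_n}) (j : 'I_n) :
  j \in A -> (A \in zones m b) = (A == same_floor j).
Proof.
move=> Aj; rewrite inE; apply/maxsetP/eqP=> [[fcA maxA]|->].
  apply/esym/maxA; first exact: floor_constant_same_floor.
  exact: floor_constant_sub.
split=> [|C fcC sSC]; first exact: floor_constant_same_floor.
apply/eqP; rewrite eqEsubset sSC andbT; apply: floor_constant_sub => //.
by apply: (subsetP sSC); rewrite inE.
Qed.

Lemma zone_ofE (j : 'I_n) : zone_of m b j = same_floor j.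
Proof.
have jS (k : 'I_n) : k \in same_floor k by rewrite inE.
apply: def_pblock (jS j); last by rewrite (zonesE (jS j)).
apply/trivIsetP=> A C zA zC; apply: contraR => /pred0Pn[k /andP[/= Ak Ck]].
by move: zA zC; rewrite (zonesE Ak) (zonesE Ck) => /eqP-> /eqP->.
Qed.

Lemma zone_remE (j : 'I_n) :
  zone_rem m b (zone_of m b j)
  = (\sum_(i < n | (b i %/ m == b j %/ m)%N) b i %% m)%N.
Proof.
rewrite zone_ofE; apply: eq_big => [i|i _]; first by rewrite inE.
exact: mremE.
Qed.

Lemma last_in_zoneP (j : 'I_n) :
  reflect (forall i : 'I_n, b i %/ m = b j %/ m -> (i <= j)%N)%N
          (last_in_zone m b j).
Proof.
rewrite /last_in_zone zone_ofE.
apply: (iffP forall_inP) => le_j i.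
  by move=> eq_i; apply: le_j; rewrite inE eq_i.
by rewrite inE => /eqP; apply: le_j.
Qed.

(** * Recurrences for the rook polynomials *)

Section RookPolynomial.

Variables (R : comPzRingType) (x : R).

(** [rook_poly], [avoid_poly] and [using_poly] are the sums F, A and C; the level [q] is a parameter
    because it changes from zone to zone. *)
Definition rook_poly (k : nat) : R :=
  \sum_(P | prefix_placement k P) mfalling m x (k - #|P|).

Definition avoid_poly (q k : nat) : R :=
  \sum_(P | prefix_placement k P)
     (if uses q P then 0 else mfalling m x (k - #|P|)).

Definition using_poly (q k : nat) : R :=
  \sum_(P | prefix_placement k P)
     (if uses q P then mfalling m x (k - #|P|) else 0).

Lemma rook_polyE (q k : nat) : rook_poly k = avoid_poly q k + using_poly q k.
Proof.
rewrite /rook_poly -big_split; apply: eq_bigr => P _ /=.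
by case: ifP; rewrite ?addr0 ?add0r.
Qed.

Lemma using_poly_eq0 (q k : nat) :
    (forall j : 'I_n, (j < k)%N -> (b j %/ m < q)%N) ->
  using_poly q k = 0.
Proof.
by move=> lt_q; apply: big1 => P /(prefix_level_ltn lt_q) ->.
Qed.

(** Leaving column [p] empty adds one factor to the falling factorial, whereas a rook there keeps it
    unchanged. *)
Lemma mfalling_skip (p : 'I_n) P : prefix_placement p P ->
  mfalling m x (p.+1 - #|P|)
  = (x - p%:R * m%:R + #|P|%:R * m%:R) * mfalling m x (p - #|P|).
Proof.
move=> plP; have leP := card_prefix_le plP.
by rewrite subSn // mfallingS natrM natrB //; ring.
Qed.

Lemma card_setU1_prefix p P i :
  prefix_placement p P -> (p.+1 - #|(p, i) |: P| = p - #|P|)%N.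
Proof. by move=> plP; rewrite cardsU1 (placement_notin i plP) subSS. Qed.

Lemma sum_free p P (V : nmodType) (f : bool -> V) (q : nat) :
  \sum_(i | free p P i) f (level m i == q)
  = f false *+ #|[pred i | free p P i & level m i != q]|
    + f true *+ #|[pred i | free p P i & ~~ (level m i != q)]|.
Proof.
rewrite (bigID (fun i => level m i != q)) /= -!sumr_const; congr (_ + _).
  by apply: eq_big => [i|i /andP[_ /negPf->]]; rewrite ?inE.
by apply: eq_big => [i|i /andP[_ /negPn->]]; rewrite ?inE.
Qed.

(** The term [m * #|P|] gained from an empty column cancels the one lost in the count of free cells,
    so the factor does not depend on [P]. *)
Lemma avoid_polyS p (q := (b p %/ m)%N) :
  avoid_poly q p.+1 = (x + q%:R * m%:R - p%:R * m%:R) * avoid_poly q p.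
Proof.
rewrite /avoid_poly big_prefixS big_distrr /=; apply: eq_bigr => P plP.
under eq_bigr => i _ do rewrite uses_setU1 card_setU1_prefix //.
have := card_free_below plP; rewrite -/q.
case: (uses q P) => /=.
  by move=> _; rewrite big1 => [|i _]; rewrite ?orbT // addr0 mulr0.
rewrite muln0 addn0 => /(congr1 (fun k => k%:R : R)).
rewrite natrD !natrM => cnt.
under eq_bigr => i _ do rewrite orbF.
rewrite (sum_free _ _ (fun c : bool => if c then 0 else _)) mul0rn addr0.
rewrite mfalling_skip // -[mfalling _ _ _ *+ _]mulr_natl -mulrDl; congr (_ * _).
by rewrite -cnt; ring.
Qed.

Lemma using_polyS p (q := (b p %/ m)%N) :
  using_poly q p.+1
  = (x + q%:R * m%:R + m%:R - p%:R * m%:R) * using_poly q p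
    + (b p %% m)%:R * avoid_poly q p.
Proof.
rewrite /using_poly /avoid_poly big_prefixS !big_distrr -big_split /=.
apply: eq_bigr => P plP.
under eq_bigr => i _ do rewrite uses_setU1 card_setU1_prefix //.
have := card_free_below plP; have := @card_free_level p P; rewrite -/q.
case: (boolP (uses q P)) => usq /=.
  move=> _ /(congr1 (fun k => k%:R : R)); rewrite muln1 !natrD !natrM => cnt.
  under eq_bigr => i _ do rewrite orbT.
  rewrite (sum_free _ _ (fun=> mfalling m x (p - #|P|)) q).
  (* Level [q] is already occupied by [P]. *)
  have -> : #|[pred i | free p P i & ~~ (level m i != q)]| = 0%N.
    apply: eq_card0 => i; rewrite !inE negbK; apply/negP=> /andP[/andP[_]].
    by move=> + /eqP lq; rewrite lq usq.
  rewrite mulr0n !addr0 mulr0 ?addr0 mfalling_skip //.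
  rewrite -[mfalling _ _ _ *+ _]mulr_natl -mulrDl.
  congr (_ * _); transitivity (x - p%:R * m%:R + (q%:R * m%:R + m%:R) : R).
    by rewrite -cnt; ring.
  by ring.
move=> /(_ usq) cnt _; under eq_bigr => i _ do rewrite orbF.
rewrite (sum_free _ _ (fun c : bool => if c then _ else 0)) cnt.
by rewrite mul0rn mulr0 !add0r mulr_natl.
Qed.

(** Inside a zone, the coefficient of [using_poly q p] in its recurrence is the factor by which
    [avoid_poly q] grew at the previous column, so the remainders simply add up. *)
Lemma using_poly_zone p (q := (b p %/ m)%N) :
  using_poly q p.+1
  = (\sum_(j < n | (j <= p)%N && (b j %/ m == q)%N) b j %% m)%N%:R
    * avoid_poly q p.
Proof.
rewrite {}/q; case: p => k; elim: k => [|k IHk] lt_kn; set p := Ordinal _.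
  rewrite using_polyS using_poly_eq0 // mulr0 add0r (big_pred1 p) // => j.
  rewrite /= leqn0 -val_eqE /=; case: eqP => //= j0.
  by rewrite (_ : j = p) ?eqxx //; apply: val_inj.
rewrite using_polyS (bigD1 p) ?leqnn ?eqxx //=.
pose p' := Ordinal (ltnW lt_kn).
have le_b : (b p' %/ m <= b p %/ m)%N by apply/leq_div2r/b_mono/leqnSn.
have predE (j : 'I_n) : (j <= k.+1)%N && (b j %/ m == b p %/ m)%N && (j != p)
                      = (j <= p')%N && (b j %/ m == b p %/ m)%N.
  by rewrite andbAC -val_eqE /=; congr (_ && _); lia.
rewrite (eq_bigl _ _ predE) natrD [RHS]mulrDl [RHS]addrC; congr (_ + _).
(* Column [p] either continues the zone of [p'] or opens a new one; in the latter case no earlier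
   rook reaches its level and no earlier column enters the sum. *)
move: le_b; rewrite leq_eqVlt => /orP[/eqP eq_b|lt_b].
  rewrite -eq_b (IHk (ltnW lt_kn)) (avoid_polyS p') -/p'.
  by rewrite /= -[k.+1]addn1 natrD; ring.
rewrite using_poly_eq0 => [|j]; last first.
  by rewrite ltnS => le_jk; apply: leq_ltn_trans lt_b; apply/leq_div2r/b_mono.
rewrite mulr0 big_pred0 ?mul0r // => j; apply/negP=> /andP[le_jk /eqP eq_b].
by move: lt_b; rewrite -eq_b ltnNge leq_div2r // b_mono.
Qed.

(** * The product formula *)

Definition zone_factor (j : 'I_n) : R :=
  if last_in_zone m b j
  then x + (mfloor m (b j))%:R - (j * m)%:R
       + (zone_rem m b (zone_of m b j))%:R
  else x + (mfloor m (b j))%:R - (j * m)%:R.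

(* The hypothesis on q says that q is the level of column k, or any level above
   the board if k = n; this lets a single induction cover both cases. *)
Lemma avoid_poly_prod (k q : nat) : (k <= n)%N ->
    (forall j : 'I_n, j.+1 = k ->
       if last_in_zone m b j then (b j %/ m < q)%N else (b j %/ m == q)%N) ->
  avoid_poly q k = \prod_(j < n | (j < k)%N) zone_factor j.
Proof.
elim: k q => [|k IHk] q.
  move=> _ _; rewrite [RHS]big_pred0 // /avoid_poly (big_pred1 set0).
    rewrite cards0 /mfalling big_ord0 ifF //.
    by apply/exists_inP=> -[c]; rewrite inE.
  move=> P /=; apply/idP/eqP=> [/card_prefix_le|->].
    by rewrite leqn0 cards_eq0 => /eqP.
  by apply/prefix_placementP; split=> [c|c|c d]; rewrite inE.
move=> lt_kn /(_ (Ordinal lt_kn) erefl); set p := Ordinal lt_kn => q_p.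
rewrite (bigD1 p) //=.
have -> : \prod_(j < n | (j < k.+1)%N && (j != p)) zone_factor j
        = avoid_poly (b p %/ m) p.
  rewrite (IHk (b p %/ m)%N (ltnW lt_kn)) => [|j def_k].
    apply: eq_bigl => j; rewrite -val_eqE /=; lia.
  have le_jp : (j <= p)%N by rewrite /= -def_k.
  have le_b : (b j %/ m <= b p %/ m)%N by apply/leq_div2r/b_mono.
  (* Column [j] directly precedes [p], so it ends its zone exactly when the floor increases at
     [p]. *)
  case: last_in_zoneP => [last_j|notlast].
    rewrite ltn_neqAle le_b andbT; apply/eqP=> /esym/last_j /=.
    by rewrite -def_k ltnn.
  rewrite eqn_leq le_b leqNgt; apply/negP=> lt_b; case: notlast => i eq_i.
  rewrite leqNgt; apply/negP=> lt_ji.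
  have : (b p %/ m <= b i %/ m)%N by apply/leq_div2r/b_mono; rewrite /= -def_k.
  by rewrite eq_i leqNgt lt_b.
rewrite /zone_factor mfloorE //; move: q_p.
case: last_in_zoneP => [last_p lt_q|_ /eqP <-]; last first.
  by rewrite (avoid_polyS p) !natrM.
(* At the end of a zone no rook has reached level [q], so [avoid_poly q] is the full sum, which is
   split anew at the level of [p]. *)
have := rook_polyE q k.+1; rewrite using_poly_eq0 => [|j]; last first.
  by rewrite ltnS => le_jk; apply: leq_ltn_trans lt_q; apply/leq_div2r/b_mono.
rewrite addr0 => <-; rewrite (rook_polyE (b p %/ m)) (avoid_polyS p).
rewrite (using_poly_zone p) -mulrDl !natrM zone_remE; congr ((_ + _%:R) * _).
(* As [p] ends its zone, the bound [j <= p] is automatic and the sum is the whole zone remainder. *)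
by apply: eq_bigl => j; apply: andb_idl => /eqP/last_p.
Qed.

(** Level [(height b).+1] lies above every rook, so avoiding it is no restriction. *)
Lemma rook_poly_prod : rook_poly n = \prod_(j < n) zone_factor j.
Proof.
have lt_h (j : 'I_n) : (b j %/ m < (height b).+1)%N.
  by rewrite ltnS; apply: leq_trans (leq_div _ _) (leq_height j).
rewrite (rook_polyE (height b).+1) using_poly_eq0 // addr0 avoid_poly_prod //.
  by apply: eq_bigl => j; rewrite ltn_ord.
move=> j def_n; case: last_in_zoneP => // -[] i _.
by rewrite -ltnS def_n.
Qed.

Lemma rook_poly_sum :
  \sum_(k < n.+1) (rook_number m b k)%:R * mfalling m x (n - k)%N = rook_poly n.
Proof.
have plE P : prefix_placement n P = level_placement m P.
  by rewrite /prefix_placement andb_idr // => _; apply/forall_inP=> c.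
(* Placements are grouped by size; [inord] is faithful because a placement has at most [n] rooks. *)
rewrite /rook_poly (partition_big (fun P => inord #|P| : 'I_n.+1) xpredT) //=.
apply: eq_bigr => k _; rewrite mulr_natl -sumr_const.
apply: eq_big => P; rewrite inE; last by case/andP=> _ /eqP->.
rewrite -plE; apply: andb_id2l => /card_prefix_le le_Pn.
by rewrite -val_eqE /= inordK.
Qed.

End RookPolynomial.

End Placements.

Theorem theorem2p1 (m n : nat) (b : 'I_n -> nat) (m_gt0 : (0 < m)%N)
    (b_mono : forall i j : 'I_n, (i <= j)%N -> (b i <= b j)%N) :
  \sum_(k < n.+1) (rook_number m b k)%:R * mfalling m 'X (n - k)%N
  = \prod_(j < n)
      (if last_in_zone m b j
       then 'X + (mfloor m (b j))%:R - (j * m)%:R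
            + (zone_rem m b (zone_of m b j))%:R
       else 'X + (mfloor m (b j))%:R - (j * m)%:R)
  :> {poly int}.
Proof. by rewrite rook_poly_sum rook_poly_prod. Qed.
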